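(* Let $G$ and $G'$ be groups (not necessarily finite) with identity elements $e$ and $e'$, respectively. Let $\psi \in \mathrm{Aut}(G)$ and $\psi' \in \mathrm{Aut}(G')$ be group automorphisms, let $Q = (Q(G,\psi),* )$ and $Q' = (Q(G',\psi'),*')$ be the associated generalized Alexander quandles, and let $P = P(Q) \subset G$ and $P' = P(Q') \subset G'$ be the orbits of $e$ and $e'$ under the inner automorphism groups $\mathrm{Inn}(Q)$ and $\mathrm{Inn}(Q')$, respectively. Then the following conditions (1) and (2) are equivalent: (1) $Q$ and $Q'$ are isomorphic as quandles. (2) There exists a group isomorphism $h : P \to P'$ such that the following two conditions (A) and (B) are satisfied: (A) $h \circ \psi|_P = \psi'|_{P'} \circ h$; (B) there exist complete sets of coset representatives $A \subset G$ of $G/P$ and $A' \subset G'$ of $G'/P'$, and a bijection $k : A \to A'$, such that $h(e * a) = e' *' k(a)$ holds for every $a \in A$.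
   Context: A quandle is a non-empty set $Q$ with a binary operation $*$ such that: (Q1) $x*x=x$ for all $x\in Q$; (Q2) for every $x \in Q$ the map $s_x : Q \to Q$, $s_x(y) = y*x$, is bijective; (Q3) $(x*y)*z = (x*z)*(y*z)$ for all $x,y,z \in Q$. A quandle isomorphism $f:(Q,* )\to(Q',*')$ is a bijection with $f(x*y) = f(x)*'f(y)$ for all $x,y\in Q$; $Q$ and $Q'$ are isomorphic as quandles if such an $f$ exists. For a group $G$ and a group automorphism $\psi$ of $G$, the generalized Alexander quandle $Q(G,\psi)$ is the set $G$ with the operation $x*y := y\,\psi(y^{-1}x)$; this is a quandle. In particular $e*a = a\,\psi(a^{-1})$. Likewise $*'$ denotes the operation $x*'y = y\,\psi'(y^{-1}x)$ on $G'$. The inner automorphism group $\mathrm{Inn}(Q)$ of a quandle $Q$ is the group of bijections of $Q$ generated by $\{s_x : x\in Q\}$. For $Q = Q(G,\psi)$, $P(Q)$ denotes the orbit of the identity element $e$ of $G$ under $\mathrm{Inn}(Q)$: $$P(Q) = \{ s_{x_n}^{\pm1}\circ s_{x_{n-1}}^{\pm1}\circ\cdots\circ s_{x_1}^{\pm1}(e) : n\in\mathbb{Z}_{>0},\ x_1,\dots,x_n\in Q\}.$$ It is a known fact that $P(Q)$ is a normal subgroup of $G$ (and a subquandle of $Q$), and it is regarded as a group with the operation of $G$. The restriction $\psi|_P$ maps $P$ to $P$, and $e*a \in P$ for every $a\in G$. A complete set of coset representatives of $G/P$ is a subset $A\subset G$ containing exactly one element of each coset of $P$ in $G$. *)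

(* Defs.v *)
From HB Require Import structures.
From mathcomp Require Import all_boot.
From mathcomp Require Import boolp classical_sets functions.
Set Implicit Arguments.
Unset Strict Implicit.
Unset Printing Implicit Defensive.
Local Open Scope classical_set_scope.
Local Open Scope group_scope.

Reserved Notation "x ▷ y" (at level 40, left associativity).

Record quandle := Quandle {
  qsort :> Type;
  qop : qsort -> qsort -> qsort;
  quandle_inhabited : inhabited qsort;
  qopxx : forall x, qop x x = x;
  qop_bij : forall x, bijective (fun y => qop y x);
  qopD : forall x y z, qop (qop x y) z = qop (qop x z) (qop y z) }.

Notation "x ▷ y" := (qop x y).

Definition quandle_sym (Q : quandle) (x : Q) : Q -> Q := fun y => y ▷ x.

Definition quandle_isomorphic (Q Q' : quandle) : Prop :=
  exists2 f : Q -> Q', bijective f & {morph f : x y / x ▷ y}.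

(* The subgroup generated by the maps s_x in the group of bijections of Q. *)
Inductive Inn (Q : quandle) : set (Q -> Q) :=
| Inn_sym x : Inn (quandle_sym x)
| Inn_id : Inn id
| Inn_comp f g : Inn f -> Inn g -> Inn (f \o g)
| Inn_inv f g : Inn f -> cancel f g -> cancel g f -> Inn g.

Definition Inn_orbit (Q : quandle) (x : Q) : set Q :=
  [set f x | f in @Inn Q].

Section GeneralizedAlexander.
Variables (G : groupType) (psi : {multiplicative G -> G}).
Hypothesis psi_bij : bijective psi.

Definition galex_op (x y : G) : G := y * psi (y^-1 * x).

Lemma galex_opxx x : galex_op x x = x.
Proof.
suff psi1 : psi 1 = 1 by rewrite /galex_op mulVg psi1 mulg1.
by apply: (mulgI (psi 1)); rewrite -gmulfM !mulg1.
Qed.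

Lemma galex_op_bij x : bijective (fun y => galex_op y x).
Proof.
case: psi_bij => phi psiK phiK; exists (fun z => x * phi (x^-1 * z)) => y.
  by rewrite /galex_op mulKg psiK mulVKg.
by rewrite /galex_op mulKg phiK mulVKg.
Qed.

Lemma galex_opD x y z :
  galex_op (galex_op x y) z = galex_op (galex_op x z) (galex_op y z).
Proof.
rewrite /galex_op -mulgA; congr (z * _).
have -> : z^-1 * x = z^-1 * y * (y^-1 * x) by rewrite -mulgA mulVKg.
by rewrite invgM -mulgA mulKg (gmulfM (z^-1 * y)) mulKg -gmulfM mulgA.
Qed.

Definition galex : quandle :=
  Quandle (inhabits 1) galex_opxx galex_op_bij galex_opD.

Definition galex_orbit1 : set G := @Inn_orbit galex 1.

End GeneralizedAlexander.

(* Used only for subgroups P, P'; the values of h outside P are irrelevant. *)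
Definition group_isomorphism_on (G G' : groupType) (P : set G) (P' : set G')
    (h : G -> G') : Prop :=
  set_bij P P' h /\ forall x y, P x -> P y -> h (x * y) = h x * h y.

Definition left_coset (G : groupType) (P : set G) (g : G) : set G :=
  [set g * p | p in P].

Definition coset_representatives (G : groupType) (P A : set G) : Prop :=
  forall g : G, exists! a, (A `&` left_coset P g) a.

(* Main.v *)
(** Write [d y] for [1 ▷ y = y * psi y^-1].  The symmetry at [y] is
    [x |-> d y * psi x], so composing it with the inverse of the symmetry at [1],
    which is [psi], gives left translation by [d y].  Hence [P] consists of the
    [p] whose left translation is inner, and it is the subgroup generated by the
    [d y].  An isomorphism fixing identities intertwines these translations, so it
    satisfies [f (p * x) = f p * f x] for [p] in [P]; restrict it to [P] and to a
    set of representatives.  Conversely, set [f (p * a) = h p * k a]. *)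
Require Import Defs.
From mathcomp Require Import all_boot.
From mathcomp Require Import boolp classical_sets functions.
Set Implicit Arguments.
Unset Strict Implicit.
Local Open Scope classical_set_scope.
Local Open Scope group_scope.

Lemma multiplicative1 (G H : groupType) (f : {multiplicative G -> H}) :
  f 1 = 1.
Proof. by apply: (mulgI (f 1)); rewrite -gmulfM !mulg1. Qed.

Lemma multiplicativeV (G H : groupType) (f : {multiplicative G -> H}) x :
  f x^-1 = (f x)^-1.
Proof.
by apply: (mulgI (f x)); rewrite -gmulfM !mulgV multiplicative1.
Qed.

(** * The orbit of [1] as a normal subgroup, and its cosets *)

Section Orbit.
Variables (G : groupType) (psi : {multiplicative G -> G}).
Hypothesis psi_bij : bijective psi.

Local Notation d := (galex_op psi 1).
Local Notation P := (galex_orbit1 psi_bij).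

Lemma galex_op1E y : d y = y * (psi y)^-1.
Proof. by rewrite /galex_op mulg1 multiplicativeV. Qed.

Lemma galex_op11 : d 1 = 1.
Proof. by rewrite galex_op1E multiplicative1 mulgV. Qed.

Lemma galex_opE x y : galex_op psi x y = d y * psi x.
Proof. by rewrite galex_op1E /galex_op gmulfM multiplicativeV mulgA. Qed.

Lemma psi_galex_op1 x : psi x = (d x)^-1 * x.
Proof. by rewrite galex_op1E invgM invgK divgK. Qed.

(** For [p] and [q] in [P], every factor before the trailing [a] lies in [P], so the product stays
    in the coset of [a] and its [P]-part is explicit. *)
Lemma galex_opMM p a q b :
  galex_op psi (p * a) (q * b) =
  q * d b * (psi q)^-1 * psi p * (d a)^-1 * a.
Proof.
rewrite galex_opE (galex_op1E (q * b)) !gmulfM invgM (psi_galex_op1 a).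
by rewrite (galex_op1E b) !mulgA.
Qed.

(** The symmetry at [y] sends [x] to [d y * (d x)^-1 * x], a left multiple of [x] by an element of
    [S]; so inner maps cannot leave [S]. *)
Lemma galex_orbit1_ind (S : set G) :
    S 1 -> (forall x y, S x -> S y -> S (x * y)) ->
    (forall x, S x -> S x^-1) -> (forall y, S (d y)) ->
  P `<=` S.
Proof.
move=> S1 SM SV Sd.
have Sl x y : S x -> S (x * y) <-> S y.
  move=> Sx; split; last exact: SM.
  by move=> /(SM _ _ (SV _ Sx)); rewrite mulKg.
(* An equivalence, not an implication, so that the induction passes through inverses. *)
suff InnS (F : galex psi_bij -> galex psi_bij) :
    Inn F -> forall x : G, S (F x) <-> S x.
  by move=> _ [F InnF <-]; apply/InnS.
elim=> {F} [y x|x|f g _ IHf _ IHg x|f g _ IHf fK gK x] //.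
- rewrite /quandle_sym /= galex_opE (Sl _ _ (Sd y)) psi_galex_op1.
  by apply: Sl; exact: SV.
- by rewrite /= IHf IHg.
- by rewrite -IHf gK.
Qed.

Lemma Inn_psi : Inn (psi : galex psi_bij -> galex psi_bij).
Proof.
have -> : (psi : galex psi_bij -> galex psi_bij) =
    @quandle_sym (galex psi_bij) 1.
  by apply/funext => x; rewrite /quandle_sym /= galex_opE galex_op11 mul1g.
exact: Inn_sym.
Qed.

Lemma Inn_mulg_inv (x : G) :
  @Inn (galex psi_bij) ( *%g x) -> @Inn (galex psi_bij) ( *%g x^-1).
Proof.
by move=> Innx; apply: (Inn_inv Innx) => y; rewrite ?mulKg ?mulVKg.
Qed.

Lemma galex_orbit1P (p : G) : P p <-> @Inn (galex psi_bij) ( *%g p).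
Proof.
split=> [|Innp]; last by exists ( *%g p); rewrite ?mulg1.
apply: (@galex_orbit1_ind [set p | @Inn (galex psi_bij) ( *%g p)]) => /=.
- have -> : *%g (1 : G) = id by apply/funext => x; rewrite mul1g.
  exact: Inn_id.
- move=> x y Innx Inny.
  have -> : *%g (x * y) = *%g x \o *%g y.
    by apply/funext => z /=; rewrite mulgA.
  exact: (@Inn_comp (galex psi_bij)).
- exact: Inn_mulg_inv.
- move=> y; have [phi psiK phiK] := psi_bij.
  have -> : *%g (d y) = @quandle_sym (galex psi_bij) y \o phi.
    by apply/funext => x; rewrite /quandle_sym /= (galex_opE (phi x)) phiK.
  apply: Inn_comp; first exact: Inn_sym.
  exact: (Inn_inv Inn_psi).
Qed.

Lemma galex_orbit1_1 : P 1.
Proof. by exists id => //; exact: Inn_id. Qed.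

Lemma galex_orbit1M x y : P x -> P y -> P (x * y).
Proof.
move=> /galex_orbit1P Innx [F InnF Fy]; exists ( *%g x \o F).
  exact: (@Inn_comp (galex psi_bij)).
by rewrite /= Fy.
Qed.

Lemma galex_orbit1V x : P x -> P x^-1.
Proof. by move=> /galex_orbit1P Innx; apply/galex_orbit1P/Inn_mulg_inv. Qed.

Lemma galex_orbit1_op1 y : P (d y).
Proof.
by exists (@quandle_sym (galex psi_bij) y) => //; exact: Inn_sym.
Qed.

Lemma galex_orbit1_psi x : P x -> P (psi x).
Proof.
move=> Px; rewrite psi_galex_op1; apply: galex_orbit1M => //.
exact/galex_orbit1V/galex_orbit1_op1.
Qed.

(** Normality is checked on the generators: a conjugate of [d y] is a quotient of two generators. *)
Lemma galex_orbit1J g x : P x -> P (g * x * g^-1).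
Proof.
move: x; apply: (@galex_orbit1_ind [set x | P (g * x * g^-1)]) => /=.
- by rewrite mulg1 mulgV; exact: galex_orbit1_1.
- move=> x y Px Py; have := galex_orbit1M Px Py.
  by rewrite !mulgA divgK.
- by move=> x /galex_orbit1V; rewrite !invgM invgK mulgA.
- move=> y; suff -> : g * d y * g^-1 = d (g * y) * (d g)^-1.
    by apply: galex_orbit1M; first exact: galex_orbit1_op1;
       exact/galex_orbit1V/galex_orbit1_op1.
  by rewrite !galex_op1E gmulfM !invgM invgK !mulgA divgK.
Qed.

(** By normality left and right cosets agree. The right form suits factorisations [p * a], on which
    [P] acts by left translation. *)
Lemma left_coset_orbit1E g a : left_coset P g a <-> P (a * g^-1).
Proof.
split=> [[p Pp <-]|Pag]; first exact: galex_orbit1J.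
exists (g^-1 * a); last by rewrite mulVKg.
by have := galex_orbit1J g^-1 Pag; rewrite invgK mulgA divgK.
Qed.

Lemma coset_representatives_exist : exists A, coset_representatives P A.
Proof.
(* The choice depends only on the coset as a set, so all its members get the same representative;
   the default [1] never arises, as [g] is in its own coset. *)
pose r g := xget 1 (left_coset P g).
have rP g : left_coset P g (r g).
  by apply: xgetPex; exists g, 1; rewrite ?mulg1 //; exact: galex_orbit1_1.
exists (range r) => g; exists (r g); split=> [|_ [[g1 _ <-]]].
  by split; [exists g | exact: rP].
move=> /left_coset_orbit1E Pg; rewrite /r; congr (xget 1 _); symmetry.
have /left_coset_orbit1E Pg1 := rP g1.
have {Pg1}Pg1g : P (g1 * g^-1).
  have := galex_orbit1M (galex_orbit1V Pg1) Pg.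
  by rewrite invgM invgK mulgA divgK.
apply/seteqP; split=> a /left_coset_orbit1E Pa; apply/left_coset_orbit1E.
  by have := galex_orbit1M Pa Pg1g; rewrite mulgA divgK.
have := galex_orbit1M Pa (galex_orbit1V Pg1g).
by rewrite invgM invgK mulgA divgK.
Qed.

(** Provides the factorisation [x = (x * (r x)^-1) * r x] into a [P]-part and a representative,
    unique by the second property. *)
Lemma coset_representatives_decomp (A : set G) :
  coset_representatives P A ->
  exists2 r : G -> G, forall x, A (r x) /\ P (x * (r x)^-1) &
    forall p a, P p -> A a -> r (p * a) = a.
Proof.
move=> repA; pose S x := A `&` left_coset P x.
have rS x : S x (xget 1 (S x)).
  by case: (repA x) => a [Sa _]; apply: xgetPex; exists a.
exists (fun x => xget 1 (S x)) => [x|p a Pp Aa].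
  have [Ar /left_coset_orbit1E Pr] := rS x; split=> //.
  by have := galex_orbit1V Pr; rewrite invgM invgK.
have [b [_ b_uniq]] := repA (p * a).
rewrite -(b_uniq _ (rS (p * a))); apply: b_uniq; split=> //.
apply/left_coset_orbit1E; rewrite invgM mulgA mulgV mul1g.
exact: galex_orbit1V.
Qed.

End Orbit.

(** * Quandle morphisms that fix the identity *)

Section IsomorphismToData.
Variables (G G' : groupType).
Variables (psi : {multiplicative G -> G}) (psi' : {multiplicative G' -> G'}).
Hypotheses (psi_bij : bijective psi) (psi'_bij : bijective psi').
Variable f : G -> G'.
Hypotheses (f1 : f 1 = 1)
  (fM : {morph f : x y / galex_op psi x y >-> galex_op psi' x y}).

Local Notation d := (galex_op psi 1).
Local Notation P := (galex_orbit1 psi_bij).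
Local Notation P' := (galex_orbit1 psi'_bij).

Lemma galex_morph_op1 y : f (d y) = galex_op psi' 1 (f y).
Proof. by rewrite fM f1. Qed.

Lemma galex_morph_psi x : f (psi x) = psi' (f x).
Proof.
by have := fM x 1; rewrite f1 !(galex_opE _ x) !(galex_opE _ (f x)) !galex_op11 !mul1g.
Qed.

Lemma galex_morph_op1M y x : f (d y * x) = f (d y) * f x.
Proof.
(* Writing [x] as [psi (phi x)] turns [d y * x] into the quandle product of [phi x] and [y]. *)
have [phi _ phiK] := psi_bij; rewrite -{1 2}[x]phiK -galex_opE fM.
by rewrite galex_morph_op1 galex_opE galex_morph_psi.
Qed.

(** Letting [x] range over all of [G], beyond [P], makes [f] carry cosets of [P] into cosets of
    [P']. *)
Lemma galex_morph_orbit1 p :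
  P p -> P' (f p) /\ forall x, f (p * x) = f p * f x.
Proof.
move: p; apply: (@galex_orbit1_ind _ _ psi_bij
  [set p | P' (f p) /\ forall x, f (p * x) = f p * f x]) => /=.
- rewrite f1; split=> [|x]; first exact: galex_orbit1_1.
  by rewrite !mul1g.
- move=> p q [Pp fp] [Pq fq]; split=> [|x].
    by rewrite fp; exact: galex_orbit1M.
  by rewrite -mulgA !fp fq mulgA.
- move=> p [Pp fp].
  have fV x : f (p^-1 * x) = (f p)^-1 * f x.
    by apply: (mulgI (f p)); rewrite -fp !mulVKg.
  have fpV : f p^-1 = (f p)^-1 by rewrite -[p^-1]mulg1 fV f1 mulg1.
  by rewrite fpV; split=> //; exact: galex_orbit1V.
- move=> y; split=> [|x]; last exact: galex_morph_op1M.
  by rewrite galex_morph_op1; exact: galex_orbit1_op1.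
Qed.

End IsomorphismToData.

(** * Gluing [h] and [k] into a quandle isomorphism *)

Section DataToIsomorphism.
Variables (G G' : groupType).
Variables (psi : {multiplicative G -> G}) (psi' : {multiplicative G' -> G'}).
Hypotheses (psi_bij : bijective psi) (psi'_bij : bijective psi').

Local Notation P := (galex_orbit1 psi_bij).
Local Notation P' := (galex_orbit1 psi'_bij).

Variables (h k : G -> G') (A : set G) (A' : set G').
Hypotheses (h_iso : group_isomorphism_on P P' h)
  (h_psi : forall x, P x -> h (psi x) = psi' (h x))
  (repA : coset_representatives P A) (repA' : coset_representatives P' A')
  (k_bij : set_bij A A' k)
  (h_op1 : forall a, A a -> h (galex_op psi 1 a) = galex_op psi' 1 (k a)).

Lemma galex_isomorphic_of_orbit1 :
  quandle_isomorphic (galex psi_bij) (galex psi'_bij).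
Proof.
have [[[hP hI hS] hM] [kA kI kS]] := (h_iso, k_bij).
have h1 : h 1 = 1.
  apply: (mulgI (h 1)); rewrite -hM ?mulg1 //; exact: galex_orbit1_1.
have hV x : P x -> h x^-1 = (h x)^-1.
  move=> Px; apply: (mulgI (h x)).
  by rewrite -hM ?mulgV //; exact: galex_orbit1V.
have [r rP rK] := coset_representatives_decomp repA.
have [r' r'P r'K] := coset_representatives_decomp repA'.
pose f x := h (x * (r x)^-1) * k (r x).
have fE p a : P p -> A a -> f (p * a) = h p * k a.
  by move=> Pp Aa; rewrite /f rK // mulgK.
exists f; last first.
  move=> x y; rewrite /= -[x](divgK (r x)) -[y](divgK (r y)).
  have [Aa] := rP x; move: (r x) (x * (r x)^-1) Aa => a p Aa Pp.
  have [Ab] := rP y; move: (r y) (y * (r y)^-1) Ab => b q Ab Pq.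
  have Pb := galex_orbit1_op1 psi_bij b.
  have Pa := galex_orbit1_op1 psi_bij a.
  have Ppsi z : P z -> P (psi z) by exact: galex_orbit1_psi.
  have PM u v : P u -> P v -> P (u * v) by exact: galex_orbit1M.
  have PV u : P u -> P u^-1 by exact: galex_orbit1V.
  rewrite (fE p) // (fE q) //.
  (* Both sides now have the same shape; [h] is distributed over the five factors in [P], then
     [h_psi] and [h_op1] match them. *)
  rewrite !galex_opMM fE //; last by auto 10.
  by do 4![rewrite hM; auto 10]; rewrite !hV ?h_psi ?h_op1; auto.
have finj : injective f.
  move=> x y; rewrite -[x](divgK (r x)) -[y](divgK (r y)).
  have [Aa] := rP x; move: (r x) (x * (r x)^-1) Aa => a p Aa Pp.
  have [Ab] := rP y; move: (r y) (y * (r y)^-1) Ab => b q Ab Pq.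
  rewrite !fE // => eqf.
  (* The representative of [h p * k a] is [k a], so [r'] recovers it from the value of [f]. *)
  have eqk : k a = k b.
    by rewrite -(r'K _ _ (hP _ Pp) (kA _ Aa)) eqf r'K //; [exact: hP|exact: kA].
  have eqab : a = b by apply: kI; rewrite ?inE.
  rewrite eqab; congr (_ * b); apply: hI; rewrite ?inE //.
  by apply: (@mulIg _ (k a)); rewrite eqf eqk.
have fsurj y : exists x, f x = y.
  have [Ay Py] := r'P y.
  have [p Pp hp] := hS _ Py; have [a Aa ka] := kS _ Ay.
  by exists (p * a); rewrite fE // hp ka divgK.
have [g gK] := choice fsurj.
by exists g => // x; apply: finj; rewrite gK.
Qed.

End DataToIsomorphism.

Unset Implicit Arguments.
Set Strict Implicit.

Theorem theorem1p1 (G G' : groupType)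
    (psi : {multiplicative G -> G}) (psi' : {multiplicative G' -> G'})
    (psi_bij : bijective psi) (psi'_bij : bijective psi') :
  quandle_isomorphic (galex psi_bij) (galex psi'_bij)
  <->
  exists h : G -> G',
    [/\ group_isomorphism_on (galex_orbit1 psi_bij) (galex_orbit1 psi'_bij) h,
        (forall x, galex_orbit1 psi_bij x -> h (psi x) = psi' (h x)) &
        exists (A : set G) (A' : set G') (k : G -> G'),
          [/\ coset_representatives (galex_orbit1 psi_bij) A,
              coset_representatives (galex_orbit1 psi'_bij) A',
              set_bij A A' k &
              forall a, A a -> h (galex_op psi 1 a) = galex_op psi' 1 (k a)]].
Proof.
split=> [[f0 [g0 f0K g0K] f0M]|[h [h_iso h_psi [A [A' [k [repA repA' k_bij hk]]]]]]];
  last exact: galex_isomorphic_of_orbit1 repA repA' k_bij hk.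
(* Left translations are automorphisms of [Q'], so [f] is again an isomorphism. *)
pose f (x : G) : G' := (f0 1 : G')^-1 * f0 x.
pose g (y : G') : G := g0 ((f0 1 : G') * y).
have fK : cancel f g by move=> x; rewrite /f /g mulVKg f0K.
have gK : cancel g f by move=> x; rewrite /f /g g0K mulKg.
have f1 : f 1 = 1 by rewrite /f mulVg.
have fM : {morph f : x y / galex_op psi x y >-> galex_op psi' x y}.
  move=> x y; rewrite /f; have /= -> := f0M x y.
  by rewrite /galex_op invgM invgK !mulgA mulgK.
have g1 : g 1 = 1 by rewrite -f1 fK.
have gM : {morph g : x y / galex_op psi' x y >-> galex_op psi x y}.
  by move=> x y; apply: (can_inj fK); rewrite fM !gK.
have fP := @galex_morph_orbit1 _ _ _ _ psi_bij psi'_bij f f1 fM.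
(* The inverse is treated alike: this yields surjectivity onto [P'] and lets cosets be pulled
   back. *)
have gP := @galex_morph_orbit1 _ _ _ _ psi'_bij psi_bij g g1 gM.
have [A repA] := coset_representatives_exist psi_bij.
exists f; split.
- split; last by move=> x y /fP[].
  split=> [x /fP[]//|x y _ _|y /gP[Py _]]; first exact: (can_inj fK).
  by exists (g y) => //; exact: gK.
- by move=> x _; exact: galex_morph_psi.
(* Any [A] works: transport it along [f], with [f] itself as [k]. The representative for [y] is the
   image of the one for [g y]. *)
- exists A, (f @` A), f; split=> //; last by move=> a _; exact: galex_morph_op1.
    move=> y; have [a [[Aa /left_coset_orbit1E Pa] a_uniq]] := repA (g y).
    exists (f a); split=> [|_ [[b Ab <-]] /left_coset_orbit1E Pb].
      split; first by exists a.
      have [Pfa faM] := fP _ Pa; apply/left_coset_orbit1E.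
      by have := faM (g y); rewrite divgK gK => ->; rewrite mulgK.
    (* For uniqueness, [g] carries the coset of [y] back to that of [g y], where [a] is the only
       representative. *)
    congr f; apply: a_uniq; split=> //; apply/left_coset_orbit1E.
    have [Pgb gbM] := gP _ Pb.
    by have := gbM y; rewrite divgK fK => ->; rewrite mulgK.
  split=> [x Ax|x y _ _|//]; first by exists x.
  exact: (can_inj fK).
Qed.
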